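(* Let $\xi,\Delta:\{t_0,t_0+1,\dots\}\to\mathbb R^+$ be such that $\Delta$ and $t\mapsto\xi_t\Delta_t$ are non-increasing and $\xi$ is non-decreasing. Let $\alpha>0$, $T\in\mathbb R$, let $D=\{D_t\}_{t\ge t_0}$ be a database stream and $F=\{\{f_{t,i}\}_{i=1}^{\ell_t}\}_{t_0\le t\le t'}$ a finite query stream with sensitivity $\Delta_{f_{t,i}}\le\Delta_t$ for all $(t,i)$, such that $f_{t,i}(D_t)<T-\alpha$ for all $(t,i)\ne(t',\ell_{t'})$ and $f_{t',\ell_{t'}}(D_{t'})\ge T+\alpha$. If $$\beta\ge\sum_{t=t_0}^{t'}\ell_t\exp\!\Big(-\frac{\alpha\xi_t}{8}\Big)+\exp\!\Big(-\frac{\alpha\xi_{t_0}}{8}\Big),$$ then with probability at least $1-\beta$, $\mathrm{ATG}(D,F,T,\xi)$ does not halt before receiving the final query $f_{t',\ell_{t'}}$, every answer $a_{t,i}=\top$ satisfies $f_{t,i}(D_t)\ge T-\alpha$, and every answer $a_{t,i}=\bot$ satisfies $f_{t,i}(D_t)\le T+\alpha$.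
   Context: A database stream $D=\{D_t\}_{t\ge t_0}$ consists of databases $D_t$ of size $t$ over a finite universe, with $D_{t+1}$ obtained from $D_t$ by adding one entry. Query $f_{t,i}$ is a real-valued function on databases, arriving when the database has size $t$; its sensitivity $\Delta_{f_{t,i}}$ is $\max|f_{t,i}(E)-f_{t,i}(E')|$ over databases $E,E'$ of size $t$ differing in one entry. $\mathrm{Lap}(b)$ has density $\frac1{2b}e^{-|z|/b}$. $\mathrm{ATG}(D,F,T,\xi)$: draw $\eta\sim\mathrm{Lap}(2)$ once. For each incoming query $f_{t,i}$: draw fresh $\nu_{t,i}\sim\mathrm{Lap}(4/\xi_t)$; if $f_{t,i}(D_t)+\nu_{t,i}\ge T+\eta/\xi_t$, output $a_{t,i}=\top$ and halt; otherwise output $a_{t,i}=\bot$. *)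

(* Defs.v *)
From HB Require Import structures.
From mathcomp Require Import all_boot all_order all_algebra.
From mathcomp Require Import all_classical all_reals all_analysis.

Set Implicit Arguments.
Unset Strict Implicit.
Unset Printing Implicit Defensive.

Import Order.TTheory GRing.Theory Num.Theory.
Import numFieldNormedType.Exports.

Local Open Scope classical_set_scope.
Local Open Scope ring_scope.

Definition database (X : finType) (t : nat) : Type := t.-tuple X.

(* Only the databases D t with t0 <= t belong to the stream. *)
Definition database_stream (X : finType) (t0 : nat)
    (D : forall t : nat, database X t) : Prop :=
  forall t : nat, (t0 <= t)%N ->
    exists x : X, D t.+1 = rcons (D t) x :> seq X.

Definition differ_in_one_entry (X : finType) (t : nat)
    (E E' : t.-tuple X) : bool :=
  #|[set k : 'I_t | tnth E k != tnth E' k]%SET| == 1%N.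

(* The maximum is 0 when no two databases of size t differ in one entry. *)
Definition sensitivity (R : realType) (X : finType) (t : nat)
    (g : database X t -> R) : R :=
  \big[Num.max/0]_(p : t.-tuple X * t.-tuple X | differ_in_one_entry p.1 p.2)
     `|g p.1 - g p.2|.

(* At time t, with t0 <= t <= t', the queries are numbered 1, ..., l t. *)
Definition is_query (t0 t' : nat) (l : nat -> nat) (t i : nat) : bool :=
  [&& t0 <= t, t <= t', 1 <= i & i <= l t]%N.

Definition arrivals (t0 t' : nat) (l : nat -> nat) : seq (nat * nat) :=
  [seq (t, i) | t <- iota t0 (t'.+1 - t0), i <- iota 1 (l t)].

Definition Top : bool := true.
Definition Bot : bool := false.

(* The transcript lists the received queries with their answers, in order; it *)
(* stops right after the first Top. The arguments eta and nu are the drawn    *)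
(* noise values: nu t i is consumed only if query (t, i) is received.         *)
Fixpoint ATG_transcript (R : realType) (X : finType)
    (D : forall t : nat, database X t)
    (f : forall t : nat, nat -> database X t -> R) (T : R) (xi : nat -> R)
    (eta : R) (nu : nat -> nat -> R) (q : seq (nat * nat)) :
    seq ((nat * nat) * bool) :=
  if q is (t, i) :: q' then
    if T + eta / xi t <= f t i (D t) + nu t i then [:: ((t, i), Top)]
    else ((t, i), Bot) :: ATG_transcript D f T xi eta nu q'
  else [::].

Definition ATG (R : realType) (X : finType) (t0 t' : nat) (l : nat -> nat)
    (D : forall t : nat, database X t)
    (f : forall t : nat, nat -> database X t -> R) (T : R) (xi : nat -> R)
    (eta : R) (nu : nat -> nat -> R) : seq ((nat * nat) * bool) :=
  ATG_transcript D f T xi eta nu (arrivals t0 t' l).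

Definition laplace_pdf (R : realType) (b z : R) : R :=
  (2 * b)^-1 * expR (- (`|z| / b)).

Definition has_laplace_distribution (R : realType) (d : measure_display)
    (Omega : measurableType d) (P : probability Omega R)
    (Z : {RV P >-> R}) (b : R) : Prop :=
  forall A : set R, measurable A ->
    distribution P Z A =
    (\int[@lebesgue_measure R]_(z in A) (laplace_pdf b z)%:E)%E.

Definition mutually_independent (R : realType) (d : measure_display)
    (Omega : measurableType d) (P : probability Omega R) (I : eqType)
    (J : pred I) (Z : I -> {RV P >-> R}) : Prop :=
  forall (s : seq I) (A : I -> set R), uniq s -> all J s ->
    (forall k, measurable (A k)) ->
    P (\bigcap_(k in [set` s]) (Z k @^-1` A k)) =
    (\prod_(k <- s) P (Z k @^-1` A k))%E.

(* The noise of one execution as a single family: None is the index of the    *)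
(* threshold noise, Some (t, i) that of the noise of query (t, i).            *)
Definition noise (V : Type) (eta : V) (nu : nat -> nat -> V)
    (k : option (nat * nat)) : V :=
  if k is Some ti then nu ti.1 ti.2 else eta.

Definition noise_index (t0 t' : nat) (l : nat -> nat) :
    pred (option (nat * nat)) :=
  fun k => if k is Some ti then is_query t0 t' l ti.1 ti.2 else true.

(* eta ~ Lap(2) and nu_{t,i} ~ Lap(4 / xi_t), all mutually independent. *)
Definition ATG_noise (R : realType) (d : measure_display)
    (Omega : measurableType d) (P : probability Omega R)
    (t0 t' : nat) (l : nat -> nat) (xi : nat -> R)
    (eta : {RV P >-> R}) (nu : nat -> nat -> {RV P >-> R}) : Prop :=
  [/\ has_laplace_distribution eta 2,
      forall t i, is_query t0 t' l t i ->
        has_laplace_distribution (nu t i) (4 / xi t) &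
      mutually_independent (noise_index t0 t' l) (noise eta nu)].

(* Main.v *)
(** Every noise variable has a Laplace tail [P(|Z| >= c) <= exp(-c/b)], so by
a union bound, outside an event of probability at most [beta], all [nu_(t,i)]
are below [alpha/2] in absolute value and [|eta| < alpha * xi_t0 / 2]; the
latter gives [|eta| / xi_t < alpha/2] for all [t], as [xi] is non-decreasing.
The two perturbations together then stay below [alpha], hence every comparison
made by the algorithm agrees with that of the true query value with [T]. *)
Require Import Defs.
From HB Require Import structures.
From mathcomp Require Import all_boot all_order all_algebra.
From mathcomp Require Import zify ring lra measurable_realfun.
From mathcomp Require Import all_classical all_reals all_analysis.

Set Implicit Arguments.
Unset Strict Implicit.
Unset Printing Implicit Defensive.

Import Order.TTheory GRing.Theory Num.Theory.
Import numFieldNormedType.Exports.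

Local Open Scope classical_set_scope.
Local Open Scope ring_scope.

(** * Tails of the Laplace distribution *)

Section laplace_tail.
Context {R : realType}.
Implicit Types b c z : R.
Notation mu := (@lebesgue_measure R).

Lemma laplace_pdf_ge0 b z : 0 < b -> 0 <= laplace_pdf b z.
Proof. by move=> b0; rewrite mulr_ge0 ?expR_ge0// invr_ge0 mulr_ge0 ?ltW. Qed.

Lemma laplace_pdfN b z : laplace_pdf b (- z) = laplace_pdf b z.
Proof. by rewrite /laplace_pdf normrN. Qed.

Lemma continuous_laplace_pdf b : continuous (@laplace_pdf R b).
Proof.
move=> z; apply: cvgM; first exact: cvg_cst.
apply: continuous_comp; last exact: continuous_expR.
by apply: cvgN; apply: cvgM; [exact: norm_continuous|exact: cvg_cst].
Qed.

Lemma integral_laplace_pdf_cy b c : 0 < b -> 0 <= c ->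
  (\int[mu]_(z in `[c, +oo[) (laplace_pdf b z)%:E =
   (2^-1 * expR (- (c / b)))%:E)%E.
Proof.
move=> b0 c0.
(* On [[c, +oo[] with [0 <= c] the absolute value in the density disappears, so [F] is a primitive
   there. It tends to 0 at infinity, and the integral is [- F c]. *)
pose F z : R := - (2^-1 * expR (- b^-1 * z)).
have cF : continuous F.
  move=> z; apply: cvgN; apply: cvgM; first exact: cvg_cst.
  apply: continuous_comp; last exact: continuous_expR.
  by apply: cvgM; [exact: cvg_cst|exact: cvg_id].
have dF z : is_derive z 1 F ((2 * b)^-1 * expR (- b^-1 * z)).
  rewrite /F; apply: is_derive_eq.
  by rewrite /GRing.scale/= mulr1 invfM; ring.
rewrite (@ge0_continuous_FTC2y _ _ F _ 0)//.
- by rewrite /F EFinN oppeK add0e mulNr [b^-1 * c]mulrC.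
- by move=> z _; exact: laplace_pdf_ge0.
- by apply: continuous_subspaceT; exact: continuous_laplace_pdf.
(* The limit 0 is rewritten in the shape of [F], so that the limit rules apply factor by factor. *)
- rewrite /F -oppr0 -(mulr0 (2^-1 : R)); apply: cvgN.
  apply: cvgM; first exact: cvg_cst.
  rewrite (_ : (fun z => expR (- b^-1 * z)) =
               (fun z => expR (- z)) \o (fun z => b^-1 * z)); last first.
    by apply: eq_fun => z; rewrite mulNr.
  apply: (@cvg_comp _ _ _ _ _ _ (pinfty_nbhs R)); last exact: cvgr_expR.
  by apply: gt0_cvgMry => //; rewrite invr_gt0.
- by apply/cvg_at_right_filter; exact: cF.
- move=> z; rewrite in_itv/= andbT => cz; rewrite derive1E derive_val.
  rewrite /laplace_pdf ger0_norm; last exact: (le_trans c0 (ltW cz)).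
  by rewrite mulNr [_^-1 * z]mulrC.
Qed.

(** The density is even, so the substitution of [- z] for [z] reduces this to the upper tail. *)
Lemma integral_laplace_pdf_Nyc b c : 0 < b -> 0 <= c ->
  (\int[mu]_(z in `]-oo, (- c)%R]) (laplace_pdf b z)%:E =
   (2^-1 * expR (- (c / b)))%:E)%E.
Proof.
move=> b0 c0; rewrite ge0_integration_by_substitutionNy.
- under eq_integral do rewrite /= laplace_pdfN.
  exact: integral_laplace_pdf_cy.
- by apply: continuous_subspaceT; exact: continuous_laplace_pdf.
- by move=> z _; exact: laplace_pdf_ge0.
Qed.

(** The event is the union of two half-line events, each of probability half the bound.
    Subadditivity also covers [c = 0], where the half-lines meet. *)
Lemma laplace_tail (d : measure_display) (Omega : measurableType d)
    (P : probability Omega R) (Z : {RV P >-> R}) b c :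
  0 < b -> 0 <= c -> has_laplace_distribution Z b ->
  (P [set w | (c <= `|Z w|)%R] <= (expR (- (c / b)))%:E)%E.
Proof.
move=> b0 c0 lapZ.
have -> : [set w | c <= `|Z w|] = Z @^-1` `[c, +oo[ `|` Z @^-1` `]-oo, - c].
  apply/seteqP; split => w /=; rewrite !in_itv/= andbT lerNr ler_normr.
    by move/orP.
  by move=> H; apply/orP.
have mZ (A : set R) : measurable A -> measurable (Z @^-1` A).
  by move=> mA; rewrite -[_ @^-1` _]setTI; exact: measurable_funP.
apply: (le_trans (measureU2 _ _ _)); try exact: mZ.
have := lapZ `[c, +oo[%classic (measurable_itv _).
rewrite integral_laplace_pdf_cy// /distribution/= /pushforward => ->.
have := lapZ `]-oo, - c]%classic (measurable_itv _).
rewrite integral_laplace_pdf_Nyc// /distribution/= /pushforward => ->.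
by rewrite -EFinD lee_fin; lra.
Qed.

End laplace_tail.

(** * Union bound over the arriving queries *)

Lemma measure_bigsetU_le (d : measure_display) (T : ringOfSetsType d)
    (R : realType) (mu : {measure set T -> \bar R}) (I : eqType) (s : seq I)
    (B : I -> set T) :
  (forall k, k \in s -> measurable (B k)) ->
  (mu (\big[setU/set0]_(k <- s) B k) <= \sum_(k <- s) mu (B k))%E.
Proof.
elim: s => [|k s IHs] mB; first by rewrite !big_nil measure0.
have mBs j : j \in s -> measurable (B j).
  by move=> js; apply: mB; rewrite inE js orbT.
rewrite !big_cons; apply: (le_trans (measureU2 _ _ _)).
- by apply: mB; rewrite mem_head.
- by rewrite big_seq; apply: bigsetU_measurable.
- by apply: leeD2l; exact: IHs.
Qed.

Lemma mem_arrivals (t0 t' : nat) (l : nat -> nat) (t i : nat) :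
  ((t, i) \in arrivals t0 t' l) = is_query t0 t' l t i.
Proof.
rewrite /is_query; apply/allpairsPdep/idP => [[s [j [ + + [-> ->]]]]|].
  by rewrite !mem_iota; lia.
by exists t, i; split => //; rewrite mem_iota; lia.
Qed.

(** Turns a union bound over single queries into the sum over times of [beta_ge]. *)
Lemma sum_arrivals (V : nmodType) (t0 t' : nat) (l : nat -> nat)
    (F : nat -> V) :
  \sum_(k <- arrivals t0 t' l) F k.1 = \sum_(t0 <= t < t'.+1) F t *+ l t.
Proof.
rewrite /arrivals big_allpairs_dep/=; apply: eq_bigr => t _.
by rewrite big_const_seq count_predT size_iota iter_addr addr0.
Qed.

(** * Transcripts for fixed noise, and their measurability *)

Section transcript.
Context {R : realType} {X : finType} (D : forall t : nat, database X t).
Variables (f : forall t : nat, nat -> database X t -> R) (T : R).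
Variable xi : nat -> R.

(** Each entry records the outcome of its own comparison. The converse fails, because queries after
    the first [Top] leave no entry. *)
Lemma mem_ATG_transcript (eta : R) (nu : nat -> nat -> R)
    (q : seq (nat * nat)) (t i : nat) (b : bool) :
  ((t, i), b) \in ATG_transcript D f T xi eta nu q ->
  (t, i) \in q /\ b = (T + eta / xi t <= f i (D t) + nu t i).
Proof.
elim: q => [//|[s j] q IHq] /=; case: ifPn => cmp.
  by rewrite inE => /eqP[-> -> ->]; rewrite mem_head cmp.
rewrite inE => /orP[/eqP[-> -> ->]|/IHq[tiq ->]].
  by rewrite mem_head (negbTE cmp).
by rewrite inE tiq orbT.
Qed.

(** Halting takes a successful comparison, and only that of [k] can succeed, so the run reaches
    [k]. *)
Lemma ATG_transcript_received (eta : R) (nu : nat -> nat -> R)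
    (q : seq (nat * nat)) (k : nat * nat) :
  k \in q ->
  (forall t i, (t, i) \in q -> (t, i) <> k ->
    f i (D t) + nu t i < T + eta / xi t) ->
  k \in unzip1 (ATG_transcript D f T xi eta nu q).
Proof.
elim: q => [//|[s j] q IHq] /=; rewrite inE => kq before.
have [->|/eqP neq] := eqVneq k (s, j); first by case: ifP; rewrite mem_head.
have /negbTE-> : ~~ (T + eta / xi s <= f j (D s) + nu s j).
  by rewrite -ltNge before ?mem_head// => /esym.
case/orP: kq => [/eqP//|kq].
rewrite /= inE IHq ?orbT// => t i tiq.
by apply: before; rewrite inE tiq orbT.
Qed.

(* The predicate is generalized because [q] shrinks while the transcript keeps
   the answers already given. *)
Lemma measurable_ATG_transcript (d : measure_display)
    (Omega : measurableType d) (eta : Omega -> R)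
    (nu : nat -> nat -> Omega -> R) (q : seq (nat * nat))
    (Q : seq ((nat * nat) * bool) -> Prop) :
  measurable_fun setT eta ->
  (forall t i, measurable_fun setT (nu t i)) ->
  measurable [set w | Q (ATG_transcript D f T xi (eta w)
                           (fun t i => nu t i w) q)].
Proof.
move=> meta mnu.
have mcst (A : Prop) : measurable [set _ : Omega | A].
  have [HA|HA] := pselect A.
    by rewrite (_ : mkset _ = setT)//; apply/seteqP; split.
  by rewrite (_ : mkset _ = set0)//; apply/seteqP; split.
elim: q Q => [|[t i] q IHq] Q /=; first exact: mcst.
pose C := [set w | T + eta w / xi t <= f i (D t) + nu t i w].
have mC : measurable C.
  rewrite -[C]setTI; apply: measurable_fun_le => //.
    by apply: measurable_funD => //; exact: measurable_funM.
  exact: measurable_funD.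
(* On [C] the run halts at once and its transcript is constant, so [mcst] applies. Off [C] the
   induction hypothesis is used with the answer [Bot] absorbed into the predicate. *)
rewrite (_ : mkset _ = (C `&` [set w : Omega | Q [:: ((t, i), Top)]]) `|`
  (~` C `&` [set w | Q (((t, i), Bot) :: ATG_transcript D f T xi (eta w)
                           (fun t i => nu t i w) q)])).
  apply: measurableU; apply: measurableI => //; first exact: measurableC.
  exact: (IHq (fun a => Q (((t, i), Bot) :: a))).
apply/seteqP; split => w /=; rewrite /C/=.
  by case: ifPn => [cmp HQ|/negP cmp HQ]; [left|right].
by case: ifPn => [cmp|/negP cmp] [[]|[]].
Qed.

End transcript.

(** * Accuracy of [ATG] outside the bad noise event *)

Theorem theorem32 (R : realType) (X : finType) (t0 t' : nat)
    (xi Delta : nat -> R) (alpha beta T : R)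
    (D : forall t : nat, database X t)
    (l : nat -> nat) (f : forall t : nat, nat -> database X t -> R)
    (d : measure_display) (Omega : measurableType d) (P : probability Omega R)
    (eta : {RV P >-> R}) (nu : nat -> nat -> {RV P >-> R})
    (xi_gt0 : forall t : nat, (t0 <= t)%N -> 0 < xi t)
    (Delta_gt0 : forall t : nat, (t0 <= t)%N -> 0 < Delta t)
    (Delta_noninc : forall s t : nat, (t0 <= s)%N -> (s <= t)%N ->
       Delta t <= Delta s)
    (xiDelta_noninc : forall s t : nat, (t0 <= s)%N -> (s <= t)%N ->
       xi t * Delta t <= xi s * Delta s)
    (xi_nondec : forall s t : nat, (t0 <= s)%N -> (s <= t)%N -> xi s <= xi t)
    (alpha_gt0 : 0 < alpha)
    (D_stream : database_stream t0 D)
    (final_query : is_query t0 t' l t' (l t'))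
    (f_sensitivity : forall t i : nat, is_query t0 t' l t i ->
       sensitivity (f t i) <= Delta t)
    (f_below : forall t i : nat, is_query t0 t' l t i ->
       (t, i) <> (t', l t') -> f t i (D t) < T - alpha)
    (f_above : T + alpha <= f t' (l t') (D t'))
    (noiseP : ATG_noise t0 t' l xi eta nu)
    (beta_ge : \sum_(t0 <= t < t'.+1) (l t)%:R * expR (- (alpha * xi t / 8))
       + expR (- (alpha * xi t0 / 8)) <= beta) :
  ((1 - beta)%:E <=
   P [set w : Omega |
        (let a := ATG t0 t' l D f T xi (eta w) (fun t i => nu t i w) in
         [/\ (t', l t') \in unzip1 a,
             forall t i : nat, ((t, i), Top) \in a ->
               T - alpha <= f t i (D t) &
             forall t i : nat, ((t, i), Bot) \in a ->
               f t i (D t) <= T + alpha])%R])%E.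
Proof.
have [eta_lap nu_lap _] := noiseP.
have /and4P[t0t' _ _ _] := final_query.
pose B (k : nat * nat) := [set w | alpha / 2 <= `|nu k.1 k.2 w|].
pose E := [set w | alpha * xi t0 / 2 <= `|eta w|].
pose bad := \big[setU/set0]_(k <- arrivals t0 t' l) B k `|` E.
have mabs (Z : {RV P >-> R}) c : measurable [set w | c <= `|Z w|].
  rewrite -[X in measurable X]setTI; apply: measurable_fun_le => //.
  exact: measurableT_comp.
have mU : measurable (\big[setU/set0]_(k <- arrivals t0 t' l) B k).
  by apply: bigsetU_measurable => k _; exact: mabs.
have mbad : measurable bad by apply: measurableU => //; exact: mabs.
have Pbad : (P bad <= beta%:E)%E.
  apply: (le_trans (measureU2 _ _ _)) => //; first exact: mabs.
  apply: (@le_trans _ _ (_ + _)%:E); last by rewrite lee_fin; exact: beta_ge.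
  rewrite EFinD; apply: leeD.
    apply: (le_trans (measure_bigsetU_le _ _)) => [k _|]; first exact: mabs.
    under [X in (_ <= X%:E)%E]eq_bigr do rewrite mulr_natl.
    rewrite -(sum_arrivals t0 t' l (fun t => expR (- (alpha * xi t / 8)))).
    (* [big_seq] keeps membership in [arrivals], which supplies [t0 <= t] and the law of
       [nu t i]. *)
    rewrite -sumEFin big_seq [leRHS]big_seq; apply: lee_sum => -[t i].
    rewrite mem_arrivals => qti; have /and4P[t0t _ _ _] := qti.
    have xit := xi_gt0 _ t0t.
    (* Scale [4 / xi t] and threshold [alpha / 2] give exactly the exponent [alpha * xi t / 8]. *)
    have := laplace_tail (divr_gt0 _ xit) _ (nu_lap _ _ qti).
    move=> /(_ (alpha / 2) ltac:(done) ltac:(by rewrite divr_ge0// ltW)).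
    move=> /le_trans; apply; rewrite lee_fin ler_expR/= lerN2.
    by rewrite le_eqVlt; apply/orP; left; apply/eqP; field; rewrite gt_eqF.
  have x0 : 0 <= alpha * xi t0 by rewrite mulr_ge0 ?ltW ?xi_gt0.
  (* Scale 2 gives the exponent [alpha * xi t0 / 4], which is at least the required
     [alpha * xi t0 / 8]. *)
  have := laplace_tail _ _ eta_lap.
  move=> /(_ (alpha * xi t0 / 2) ltac:(done) ltac:(by rewrite divr_ge0)).
  move=> /le_trans; apply; rewrite lee_fin ler_expR lerN2.
  by move: x0; set x := alpha * xi t0; lra.
apply: (@le_trans _ _ (P (~` bad))).
  rewrite probability_setC// EFinB; exact: leeB.
apply: le_measure; rewrite ?inE; first exact: measurableC.
  exact: (measurable_ATG_transcript D f T xi (arrivals t0 t' l)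
    (fun a => [/\ (t', l t') \in unzip1 a,
             forall t i : nat, ((t, i), Top) \in a ->
               T - alpha <= f t i (D t) &
             forall t i : nat, ((t, i), Bot) \in a ->
               f t i (D t) <= T + alpha])).
move=> w /= /not_orP[good_nu good_eta].
have nu_small t i : is_query t0 t' l t i -> `|nu t i w| < alpha / 2.
  rewrite -mem_arrivals => tiq; rewrite ltNge; apply/negP => le_nu.
  by apply: good_nu; rewrite -bigcup_seq; exists (t, i).
have eta_small t : (t0 <= t)%N -> `|eta w / xi t| < alpha / 2.
  move=> t0t; have xit := xi_gt0 _ t0t.
  rewrite normrM normfV (gtr0_norm xit) ltr_pdivrMr//.
  have : `|eta w| < alpha * xi t0 / 2 by rewrite ltNge; apply/negP.
  move=> /lt_le_trans; apply.
  by rewrite mulrAC ler_pM2l ?divr_gt0// xi_nondec.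
have below t i : is_query t0 t' l t i -> (t, i) <> (t', l t') ->
    f t i (D t) + nu t i w < T + eta w / xi t.
  move=> qti neq; have /and4P[t0t _ _ _] := qti.
  move: (f_below _ _ qti neq) (nu_small _ _ qti) (eta_small _ t0t).
  by rewrite !ltr_norml => ? /andP[? ?] /andP[? ?]; lra.
have above : T + eta w / xi t' <= f t' (l t') (D t') + nu t' (l t') w.
  move: f_above (nu_small _ _ final_query) (eta_small _ t0t').
  by rewrite !ltr_norml => ? /andP[? ?] /andP[? ?]; lra.
split=> [|t i|t i].
- apply: ATG_transcript_received => [|t i]; rewrite mem_arrivals//.
  exact: below.
(* For the final query the bound follows from [f_above]; a [Top] on any other query contradicts
   [below]. *)
- move=> /mem_ATG_transcript[]; rewrite mem_arrivals => qti cmp.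
  have [[-> ->]|/eqP neq] := eqVneq (t, i) (t', l t').
    by apply: le_trans f_above; lra.
  by have := below _ _ qti neq; rewrite ltNge -cmp.
(* Dually, a [Bot] on the final query contradicts [above], and [f_below] settles the others. *)
- move=> /mem_ATG_transcript[]; rewrite mem_arrivals => qti cmp.
  have [[et ei]|/eqP neq] := eqVneq (t, i) (t', l t').
    by move: cmp; rewrite et ei above.
  by apply: (le_trans (ltW (f_below _ _ qti neq))); lra.
Qed.
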